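(* Let $N\ge 2$ and fix a state $x=(a,u)\in\mathbb{R}^{d_a}\times\mathbb{R}^{d_u}$ and a time $t$. Let $x_0^{(1)},\dots,x_0^{(N)}\in\mathbb{R}^{d}$, $d=d_a+d_u$, let $\varphi_n(x,t)=\varphi(x-\alpha_t x_0^{(n)})$, and let $w_n(x,t)=\varphi_n(x,t)/\sum_{j=1}^N\varphi_j(x,t)$. Let $G(x,t):=\max_{1\le j\le N}\|\partial_a\log\varphi_j(x,t)\|$ and let $p\in\arg\max_{j\in\{1,\dots,N\}} w_j(x,t)$ be an index attaining the maximal responsibility. If there exists an index $n\in\{1,\dots,N\}$ such that $$\big\|\partial_a w_n(x,t)\big\|\ge\delta\qquad\text{for some }\delta>0,$$ then there exists $q\neq p$ such that $$\Big|\big\|x-\alpha_t x_0^{(p)}\big\|_2^2-\big\|x-\alpha_t x_0^{(q)}\big\|_2^2\Big|\le 2\sigma^2(t)\log\Big(\frac{1-\tau(\delta)}{\tau(\delta)}\Big),\qquad \tau(\delta):=\frac{\delta}{2G(x,t)(N-1)}.$$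
   Context: Here $\alpha_t\in\mathbb{R}$ and $\sigma(t)>0$ are the diffusion scale and noise level at the fixed time $t$. The isotropic Gaussian kernel on $\mathbb{R}^d$ is $\varphi(r)=(2\pi\sigma^2(t))^{-d/2}\exp\big(-\|r\|_2^2/(2\sigma^2(t))\big)$. The variable $x=(a,u)$ splits into a coefficient part $a\in\mathbb{R}^{d_a}$ and a solution part $u\in\mathbb{R}^{d_u}$; $\partial_a$ denotes the gradient with respect to $a$, with $u$ and $t$ fixed, and $\|\cdot\|$ is the Euclidean norm. *)

(* Defs.v *)
From mathcomp Require Import all_boot all_order all_algebra.
From mathcomp Require Import all_classical all_reals all_analysis.

Set Implicit Arguments.
Unset Strict Implicit.
Unset Printing Implicit Defensive.

Import Order.TTheory GRing.Theory Num.Theory.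
Import numFieldNormedType.Exports.
Local Open Scope ring_scope.

(* The library norm `|v| on row vectors is the max norm, and it is this norm
   that induces the topology used by 'D_v; hence a separate Euclidean norm. *)
Definition l2norm (R : realType) (n : nat) (v : 'rV[R]_n) : R :=
  Num.sqrt (\sum_(i < n) v ord0 i ^+ 2).

(* 'D_v f a is total: it is the derivative only where f is derivable along v. *)
Definition grad (R : realType) (n : nat) (f : 'rV[R]_n -> R) (a : 'rV[R]_n) :
    'rV[R]_n :=
  \row_(i < n) 'D_(delta_mx ord0 i) f a.

(* gradient in the first block of coordinates of F : R^(da + du) -> R at the
   point (a, u), with u held fixed *)
Definition grad_a (R : realType) (da du : nat) (F : 'rV[R]_(da + du) -> R)
    (a : 'rV[R]_da) (u : 'rV[R]_du) : 'rV[R]_da :=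
  grad (fun a' => F (row_mx a' u)) a.

Definition gauss (R : realType) (d : nat) (s : R) (r : 'rV[R]_d) : R :=
  (2 * pi * s ^+ 2) `^ (- (d%:R / 2)) * expR (- (l2norm r ^+ 2 / (2 * s ^+ 2))).

Definition phi (R : realType) (d N : nat) (alpha sigma : R -> R)
    (x0 : 'I_N -> 'rV[R]_d) (n : 'I_N) (x : 'rV[R]_d) (t : R) : R :=
  gauss (sigma t) (x - alpha t *: x0 n).

Definition resp (R : realType) (d N : nat) (alpha sigma : R -> R)
    (x0 : 'I_N -> 'rV[R]_d) (n : 'I_N) (x : 'rV[R]_d) (t : R) : R :=
  phi alpha sigma x0 n x t / \sum_(j < N) phi alpha sigma x0 j x t.

(* The base value 0 of the iterated maximum is harmless: the terms are
   nonnegative, so for N > 0 this is their maximum. *)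
Definition maxscore (R : realType) (da du N : nat) (alpha sigma : R -> R)
    (x0 : 'I_N -> 'rV[R]_(da + du)) (a : 'rV[R]_da) (u : 'rV[R]_du) (t : R) : R :=
  \big[Num.max/0]_(j < N)
    l2norm (grad_a (fun x => ln (phi alpha sigma x0 j x t)) a u).

Definition tau (R : realType) (G : R) (N : nat) (delta : R) : R :=
  delta / (2 * G * (N%:R - 1)).

(* Main.v *)
Require Import Defs.
From mathcomp Require Import all_boot all_order all_algebra.
From mathcomp Require Import all_classical all_reals all_analysis.
From mathcomp Require Import ring.

Set Implicit Arguments.
Unset Strict Implicit.
Unset Printing Implicit Defensive.

Import Order.TTheory GRing.Theory Num.Theory.
Import numFieldNormedType.Exports.
Local Open Scope ring_scope.

(* Write [w j] for the responsibilities and [s j] for the gradients of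
   [log phi j].  Then [grad w n] is the sum over [j] of [w n * w j] times
   [s n - s j], so its norm is at most [2 G w n (1 - w n)].  Hence
   [delta / (2 G) <= 1 - w p], and some [q <> p] carries at least a fraction
   [1 / (N - 1)] of the mass [1 - w p], i.e. [tau <= w q].  As also
   [w p <= 1 - w q <= 1 - tau], the log-ratio of [w p] and [w q], which is the
   difference of squared distances up to the factor [2 sigma^2], is at most
   [log ((1 - tau) / tau)]; it is nonnegative by the maximality of [p]. *)

(** * The Euclidean norm and a bound for weighted differences *)

Lemma l2norm_ge0 (R : realType) n (v : 'rV[R]_n) : 0 <= l2norm v.
Proof. exact: sqrtr_ge0. Qed.

Lemma l2norm_sqr (R : realType) n (v : 'rV[R]_n) :
  l2norm v ^+ 2 = \sum_(i < n) v ord0 i ^+ 2.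
Proof. by rewrite sqr_sqrtr// sumr_ge0// => i _; exact: sqr_ge0. Qed.

Lemma l2normZ (R : realType) n k (v : 'rV[R]_n) :
  l2norm (k *: v) = `|k| * l2norm v.
Proof.
rewrite /l2norm -sqrtr_sqr -sqrtrM ?sqr_ge0//; congr Num.sqrt.
by rewrite mulr_sumr; apply: eq_bigr => i _; rewrite mxE exprMn.
Qed.

Lemma l2norm0 (R : realType) n : l2norm (0 : 'rV[R]_n) = 0.
Proof. by rewrite -(scale0r 0) l2normZ normr0 mul0r. Qed.

Lemma l2normN (R : realType) n (v : 'rV[R]_n) : l2norm (- v) = l2norm v.
Proof. by rewrite -scaleN1r l2normZ normrN1 mul1r. Qed.

Lemma l2norm0_eq0 (R : realType) n (v : 'rV[R]_n) : l2norm v = 0 -> v = 0.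
Proof.
move=> v0; apply/rowP => i; rewrite mxE; apply/eqP; rewrite -sqrf_eq0.
apply/eqP; apply: (@psumr_eq0P R _ predT (fun i => v ord0 i ^+ 2)) => //.
  by move=> j _; exact: sqr_ge0.
by rewrite -l2norm_sqr v0 expr0n.
Qed.

(** Cauchy-Schwarz: with [a] and [b] the two norms and [c] the dot product, the squares
    [(b * x_i - a * y_i) ^+ 2] sum to [2 * (a * b) * (a * b - c)], which is therefore
    nonnegative. *)
Lemma dot_le_l2norm (R : realType) n (x y : 'rV[R]_n) :
  \sum_(i < n) x ord0 i * y ord0 i <= l2norm x * l2norm y.
Proof.
have [xy0|xy_neq0] := eqVneq (l2norm x * l2norm y) 0.
  rewrite xy0 big1// => i _.
  by move/eqP: xy0; rewrite mulf_eq0 => /orP[] /eqP/l2norm0_eq0 ->;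
    rewrite mxE ?mul0r ?mulr0.
have xy_gt0 : 0 < l2norm x * l2norm y.
  by rewrite lt_neqAle eq_sym xy_neq0 mulr_ge0 ?l2norm_ge0.
set a := l2norm x in xy_gt0 *; set b := l2norm y in xy_gt0 *.
have : 0 <= \sum_(i < n) (b * x ord0 i - a * y ord0 i) ^+ 2.
  by apply: sumr_ge0 => i _; exact: sqr_ge0.
rewrite (eq_bigr (fun i => b ^+ 2 * x ord0 i ^+ 2
  - 2 * (a * b) * (x ord0 i * y ord0 i) + a ^+ 2 * y ord0 i ^+ 2)); last first.
  by move=> i _; ring.
rewrite big_split/= sumrB -!mulr_sumr -!l2norm_sqr -/a -/b.
set c := \sum_(i < n) _.
rewrite (_ : _ + _ = 2 * (a * b) * (a * b - c)); last by ring.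
have ab_gt0 : 0 < 2 * (a * b) by rewrite mulr_gt0.
by rewrite (pmulr_rge0 _ ab_gt0) subr_ge0.
Qed.

Lemma l2normD (R : realType) n (x y : 'rV[R]_n) :
  l2norm (x + y) <= l2norm x + l2norm y.
Proof.
rewrite -ler_sqr ?nnegrE ?addr_ge0 ?l2norm_ge0//.
rewrite sqrrD !l2norm_sqr.
rewrite (eq_bigr (fun i => x ord0 i ^+ 2 + 2 * (x ord0 i * y ord0 i)
  + y ord0 i ^+ 2)); last by move=> i _; rewrite mxE; ring.
rewrite big_split/= big_split/= -mulr_sumr.
rewrite lerD2r lerD2l -[leRHS]mulr_natl ler_pM2l//.
exact: dot_le_l2norm.
Qed.

Lemma l2norm_sum (R : realType) n I (r : seq I) (P : pred I)
    (v : I -> 'rV[R]_n) :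
  l2norm (\sum_(i <- r | P i) v i) <= \sum_(i <- r | P i) l2norm (v i).
Proof.
elim/big_ind2: _ => [|x a y b xa yb|//]; first by rewrite l2norm0.
by rewrite (le_trans (l2normD _ _))// lerD.
Qed.

(** The term [j = n] vanishes, each other term has norm at most [2 * G * w n * w j], and the weights
    other than [w n] sum to [1 - w n]. *)
Lemma l2norm_weighted_sub (R : realType) N d (w : 'I_N -> R)
    (s : 'I_N -> 'rV[R]_d) (G : R) n :
  (forall j, 0 <= w j) -> \sum_(j < N) w j = 1 ->
  (forall j, l2norm (s j) <= G) ->
  l2norm (\sum_(j < N) (w n * w j) *: (s n - s j))
  <= 2 * G * (w n * (1 - w n)).
Proof.
move=> w_ge0 w1 sG; rewrite (le_trans (l2norm_sum _ _ _))// (bigD1 n)//=.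
rewrite subrr scaler0 l2norm0 add0r.
have -> : 1 - w n = \sum_(j < N | j != n) w j.
  by rewrite -w1 (bigD1 n)//= addrAC subrr add0r.
rewrite !mulr_sumr; apply: ler_sum => j _.
rewrite l2normZ ger0_norm ?mulr_ge0// mulrC ler_wpM2r ?mulr_ge0//.
by rewrite (le_trans (l2normD _ _))// l2normN mulr_natl mulr2n lerD.
Qed.

(** * Directional derivatives: chain rule, logarithm, softmax *)

Section derive_along.
Context {R : realType} {V : normedModType R}.
Implicit Types (f : V -> R) (a v : V).

Lemma derive_along f a v : 'D_v f a = 'D_1 (fun h : R => f (h *: v + a)) 0.
Proof.
rewrite /derive; set g1 := fun h => h^-1 *: _; set g2 := fun h => h^-1 *: _.
suff -> : g1 = g2 by [].
by apply/funext => h; rewrite /g1 /g2 /= addr0 scale0r add0r [_%:A]mulr1.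
Qed.

(** Restricting to the line through [a] in direction [v] reduces this to the one-variable chain
    rule, so [f] need only be derivable along [v]. *)
Lemma is_derive_comp_along (g : R -> R) f a v (dg df : R) :
  is_derive (f a) 1 g dg -> is_derive a v f df ->
  is_derive a v (g \o f) (dg * df).
Proof.
move=> dgfa [fav dfav].
have dl : is_derive (0 : R) 1 (fun h : R => f (h *: v + a)) df.
  by split; [exact: (derivable1P f a v).1|rewrite -derive_along].
have [] : is_derive (0 : R) 1 (g \o (fun h : R => f (h *: v + a))) (dg * df).
  by apply: is_derive1_comp; rewrite /= scale0r add0r.
move=> dgf dgfE; split; last by rewrite derive_along.
exact: (derivable1P (g \o f) a v).2.
Qed.

Lemma derive_ln f a v : 0 < f a -> derivable f a v ->
  'D_v (fun x => ln (f x)) a = 'D_v f a / f a.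
Proof.
move=> fa0 /derivableP dfa.
have [_ ->] := is_derive_comp_along (is_derive1_ln fa0) dfa.
exact: mulrC.
Qed.

(** Quotient rule, rewritten through [D f = f * D (ln f)]; positivity of the [f j] makes every
    logarithm and quotient legitimate. *)
Lemma derive_softmax N (f : 'I_N -> V -> R) n a v :
  (forall j, 0 < f j a) -> (forall j, derivable (f j) a v) ->
  'D_v (fun x => f n x / \sum_(j < N) f j x) a =
  \sum_(j < N) (f n a / \sum_(k < N) f k a) * (f j a / \sum_(k < N) f k a) *
    ('D_v (fun x => ln (f n x)) a - 'D_v (fun x => ln (f j x)) a).
Proof.
move=> f_gt0 df.
pose F x := \sum_(j < N) f j x.
have F_neq0 : F a != 0.
  rewrite gt_eqF// /F (bigD1 n)//= ltr_pwDl// sumr_ge0// => j _; exact: ltW.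
have FE : F = \sum_(j < N) f j by apply/funext => x; rewrite fct_sumE.
have dF : derivable F a v by rewrite FE; exact: derivable_sum.
have -> : 'D_v (fun x => f n x / \sum_(j < N) f j x) a =
    f n a * 'D_v (fun x => (F x)^-1) a + (F a)^-1 * 'D_v (f n) a.
  exact: (deriveM (df n) (derivableV F_neq0 dF)).
rewrite (deriveV F_neq0 dF) {2}FE derive_sum// -/(F a).
(* Undoing the logarithmic derivatives separates the sum into a multiple of [F a] and a multiple of
   the derivative of [F], as in the quotient rule. *)
rewrite [RHS](eq_bigr (fun j => 'D_v (f n) a / F a ^+ 2 * f j a
    - f n a / F a ^+ 2 * 'D_v (f j) a)); last first.
  move=> j _; rewrite (derive_ln (f_gt0 n) (df n)) (derive_ln (f_gt0 j) (df j)).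
  by field; rewrite F_neq0 !gt_eqF.
rewrite sumrB -!mulr_sumr -/(F a) /GRing.scale/=.
by field.
Qed.

End derive_along.

(** * Positivity and derivability of the Gaussian kernel *)

Lemma gauss_gt0 (R : realType) d (s : R) (r : 'rV[R]_d) : 0 < s ->
  0 < gauss s r.
Proof.
move=> s0; rewrite mulr_gt0 ?expR_gt0// powR_gt0//.
by rewrite !mulr_gt0 ?pi_gt0 ?exprn_gt0.
Qed.

Lemma derivable_coord (R : realType) d i (r v : 'rV[R]_d) :
  derivable (fun x : 'rV[R]_d => x ord0 i) r v.
Proof.
have /derivable_mxP did : derivable (id : 'rV[R]_d -> 'rV[R]_d) r v.
  exact: derivable_id.
exact: did.
Qed.

Lemma derivable_gauss (R : realType) d (s : R) (r v : 'rV[R]_d) :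
  derivable (gauss s) r v.
Proof.
pose c : R := (2 * pi * s ^+ 2) `^ (- (d%:R / 2)).
pose Q : 'rV[R]_d -> R := fun x => - (l2norm x ^+ 2 / (2 * s ^+ 2)).
have dQ : derivable Q r v.
  pose sq i (x : 'rV[R]_d) := x ord0 i ^+ 2.
  have dsq i : derivable (sq i) r v.
    exact: (derivableX (n := 2) (@derivable_coord R d i r v)).
  have -> : Q = - (2 * s ^+ 2)^-1 *: \sum_(i < d) sq i.
    apply/funext => x; rewrite /Q l2norm_sqr /= fct_sumE.
    by rewrite -[RHS]/(_ * _) mulNr mulrC.
  apply: derivableZ.
  exact: derivable_sum dsq.
have [dE _] := is_derive_comp_along (is_derive_expR (Q r)) (derivableP dQ).
exact: (@derivableZ _ _ _ _ c _ _ dE).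
Qed.

(** Moving [a] along [v] with [u] fixed moves the argument of the kernel along [row_mx v 0], so both
    functions have the same restriction to a line. *)
Lemma derivable_phi_a (R : realType) da du N (alpha sigma : R -> R)
    (x0 : 'I_N -> 'rV[R]_(da + du)) j (a v : 'rV[R]_da) (u : 'rV[R]_du) t :
  derivable (fun a' => phi alpha sigma x0 j (row_mx a' u) t) a v.
Proof.
pose r := row_mx a u - alpha t *: x0 j.
have dg := (derivable1P (gauss (sigma t)) r (row_mx v 0)).1
  (@derivable_gauss R (da + du) (sigma t) r (row_mx v 0)).
apply: (derivable1P _ _ _).2.
suff -> : (fun h : R => phi alpha sigma x0 j (row_mx (h *: v + a) u) t) =
    (fun h : R => gauss (sigma t) (h *: row_mx v 0 + r)) by [].
apply/funext => h.
by rewrite /phi /r addrA scale_row_mx add_row_mx scaler0 add0r.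
Qed.

(** * Responsibilities, their gradients and their log-ratios *)

Section responsibilities.
Context {R : realType} {da du N : nat}.
Context {alpha sigma : R -> R} {x0 : 'I_N -> 'rV[R]_(da + du)}.
Context {a : 'rV[R]_da} {u : 'rV[R]_du} {t : R} (sigma_gt0 : 0 < sigma t).

Let w j := resp alpha sigma x0 j (row_mx a u) t.
Let score j := grad_a (fun x => ln (phi alpha sigma x0 j x t)) a u.
Let G := maxscore alpha sigma x0 a u t.

(** The index [i] only witnesses that the sum is nonempty. *)
Lemma sum_phi_gt0 (i : 'I_N) (x : 'rV[R]_(da + du)) :
  0 < \sum_(j < N) phi alpha sigma x0 j x t.
Proof.
rewrite (bigD1 i)//= ltr_pwDl ?gauss_gt0// sumr_ge0// => k _.
exact/ltW/gauss_gt0.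
Qed.

Lemma resp_gt0 j : 0 < w j.
Proof. by rewrite divr_gt0 ?gauss_gt0// sum_phi_gt0. Qed.

Lemma sum_resp (i : 'I_N) : \sum_(j < N) w j = 1.
Proof. by rewrite -mulr_suml divff// gt_eqF// sum_phi_gt0. Qed.

Lemma grad_resp n :
  grad_a (fun x => resp alpha sigma x0 n x t) a u =
  \sum_(j < N) (w n * w j) *: (score n - score j).
Proof.
apply/rowP => i; rewrite summxE mxE.
rewrite (@derive_softmax _ _ _
  (fun j a' => phi alpha sigma x0 j (row_mx a' u) t))/=.
- by apply: eq_bigr => j _; rewrite !mxE.
- by move=> j; exact: gauss_gt0.
- by move=> j; exact: derivable_phi_a.
Qed.

Lemma score_le_maxscore j : l2norm (score j) <= G.
Proof. exact: (le_bigmax _ (fun j => l2norm (score j))). Qed.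

Lemma l2norm_grad_resp n :
  l2norm (grad_a (fun x => resp alpha sigma x0 n x t) a u)
  <= 2 * G * (w n * (1 - w n)).
Proof.
rewrite grad_resp; apply: l2norm_weighted_sub score_le_maxscore.
  by move=> j; exact/ltW/resp_gt0.
exact: sum_resp.
Qed.

(** The common denominator and the Gaussian prefactor cancel in the ratio, leaving a quotient of
    exponentials. *)
Lemma ln_resp_ratio p q :
  ln (w p / w q) =
  (l2norm (row_mx a u - alpha t *: x0 q) ^+ 2 -
   l2norm (row_mx a u - alpha t *: x0 p) ^+ 2) / (2 * sigma t ^+ 2).
Proof.
rewrite /w /resp invf_div mulrA divfK; last by rewrite gt_eqF ?(sum_phi_gt0 p).
rewrite /phi /gauss -mulf_div divff ?mul1r; last first.
  by rewrite gt_eqF// powR_gt0// !mulr_gt0 ?pi_gt0 ?exprn_gt0.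
by rewrite -expRB expRK opprK addrC mulrBl.
Qed.

End responsibilities.

(* [w n * (1 - w n) <= 1 - w p] for all [n] and [p]: bound [w n] by [1] when
   [n = p], and by [1 - w p] otherwise. *)
Lemma exists_large_weight_neq (R : realFieldType) N (w : 'I_N -> R) p n
    (c : R) :
  (2 <= N)%N -> (forall j, 0 <= w j) -> \sum_(j < N) w j = 1 ->
  c <= w n * (1 - w n) ->
  exists2 q, q != p & c / (N%:R - 1) <= w q.
Proof.
move=> N_ge2 w_ge0 w1 cn.
have sumE k : \sum_(j < N | j != k) w j = 1 - w k.
  by rewrite -w1 [in RHS](bigD1 k)//= addrAC subrr add0r.
have w_le1 k : w k <= 1 by rewrite -subr_ge0 -sumE sumr_ge0.
have cp : c <= \sum_(j < N | j != p) w j.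
  have [np|np] := eqVneq n p.
    by rewrite (le_trans cn)// sumE -np ler_piMl// subr_ge0.
  rewrite (le_trans cn)// (bigD1 n)//= (le_trans (ler_piMr _ _))//.
    by rewrite gerBl.
  by rewrite lerDl sumr_ge0.
have N1_gt0 : 0 < N%:R - 1 :> R by rewrite subr_gt0 ltr1n.
(* Pigeonhole by contradiction: if each of the [N - 1] weights were below [c / (N - 1)], their sum
   would be below [c]. Strictness needs an index other than [p], which [2 <= N] supplies. *)
apply/exists_inP; rewrite -[X in is_true X]negbK negb_exists_in.
apply/negP => /forall_inP w_lt.
suff : \sum_(j < N | j != p) w j < c by rewrite ltNge cp.
have -> : c = \sum_(j < N | j != p) c / (N%:R - 1).
  rewrite sumr_const cardC1 card_ord -[RHS]mulr_natr -subn1 natrB 1?ltnW//.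
  by rewrite divfK ?gt_eqF.
have [m mp] : exists m, m \in predC1 p.
  by apply/card_gt0P; rewrite cardC1 card_ord -subn1 subn_gt0.
apply: ltr_sum => [|j jp]; last by rewrite ltNge w_lt.
by apply/hasP; exists m; rewrite ?mem_index_enum.
Qed.

(** * From a large gradient to a small gap of squared distances *)

Theorem theoremE2 (R : realType) (da du N : nat) (hN : (2 <= N)%N)
    (alpha sigma : R -> R) (t : R) (hsigma : 0 < sigma t)
    (x0 : 'I_N -> 'rV[R]_(da + du)) (a : 'rV[R]_da) (u : 'rV[R]_du)
    (p : 'I_N)
    (hp : forall j : 'I_N,
       resp alpha sigma x0 j (row_mx a u) t <= resp alpha sigma x0 p (row_mx a u) t)
    (delta : R) (hdelta : 0 < delta)
    (hgrad : exists n : 'I_N,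
       delta <= l2norm (grad_a (fun x => resp alpha sigma x0 n x t) a u)) :
  let x := row_mx a u in
  let td := tau (maxscore alpha sigma x0 a u t) N delta in
  exists q : 'I_N, q <> p /\
    `| l2norm (x - alpha t *: x0 p) ^+ 2 - l2norm (x - alpha t *: x0 q) ^+ 2 |
      <= 2 * sigma t ^+ 2 * ln ((1 - td) / td).
Proof.
move=> x td.
have [n dn] := hgrad.
pose w j := resp alpha sigma x0 j x t.
pose G := maxscore alpha sigma x0 a u t.
have w_gt0 j : 0 < w j by exact: resp_gt0.
have w1 : \sum_(j < N) w j = 1 by exact: sum_resp.
have dG : delta <= 2 * G * (w n * (1 - w n)).
  by rewrite (le_trans dn)// l2norm_grad_resp.
have s_gt0 : 0 < 2 * sigma t ^+ 2 by rewrite mulr_gt0// exprn_gt0.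
have lnE q : l2norm (x - alpha t *: x0 q) ^+ 2
    - l2norm (x - alpha t *: x0 p) ^+ 2 = 2 * sigma t ^+ 2 * ln (w p / w q).
  by rewrite ln_resp_ratio// mulrC divfK// gt_eqF.
have wp_max j : w j <= w p by exact: hp.
(* From here on [w] is an abstract probability vector, tied to the Gaussians only by [dG] and
   [lnE]. *)
clearbody w.
have w_ge0 j : 0 <= w j by exact: ltW.
have wn_le1 : w n <= 1.
  by rewrite -w1 (bigD1 n)//= lerDl sumr_ge0.
(* The maximum is only nonnegative in general; [delta > 0] rules out a vanishing one, so [td] has a
   positive denominator. *)
have G_gt0 : 0 < 2 * G.
  rewrite ltNge; apply/negP => G_le0.
  have : delta <= 0.
    by rewrite (le_trans dG)// mulr_le0_ge0// mulr_ge0 ?subr_ge0.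
  by rewrite leNgt hdelta.
have [q qp] : exists2 q, q != p & delta / (2 * G) / (N%:R - 1) <= w q.
  apply: (@exists_large_weight_neq _ _ _ _ n) => //.
  by rewrite ler_pdivrMr// mulrC.
rewrite -mulrA -invfM -/(tau G N delta) -/td => tdq.
exists q; split; first exact/eqP.
have N1_gt0 : 0 < N%:R - 1 :> R by rewrite subr_gt0 ltr1n.
have td_gt0 : 0 < td by rewrite divr_gt0// mulr_gt0.
(* Since [q != p], [w p + w q <= 1]. *)
have wp_le : w p <= 1 - td.
  rewrite lerBrDr (le_trans (lerD (lexx _) tdq))//.
  by rewrite -w1 (bigD1 p)//= lerD2l (bigD1 q)//= lerDl sumr_ge0.
rewrite distrC lnE normrM gtr0_norm// ler_pM2l//.
rewrite ger0_norm; last by rewrite ln_ge0// ler_pdivlMr// mul1r.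
(* As [0 < w p <= 1 - td], the logarithm on the right has a positive argument; the ratios are then
   compared factor by factor. *)
have td1_gt0 : 0 < 1 - td by exact: lt_le_trans wp_le.
rewrite ler_ln ?posrE; [|exact: divr_gt0..].
by rewrite ler_pM ?invr_ge0// lef_pV2 ?posrE.
Qed.
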